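(* The set of axioms $\mathcal{R}=\{$(R1), (R2), (R3), (R4), (R5), (R6), (R8$'$), (R9), (R10)$\}$ is independent. That is, for each axiom $\varphi$ in $\mathcal{R}$, $\varphi$ is not derivable from the other axioms of $\mathcal{R}$: there is an algebra $(A,+,-,;,{}^{\smile},1')$ in which $\varphi$ fails and in which all the other axioms of $\mathcal{R}$ are valid.
   Context: All algebras have the form $\mathfrak{A}=(A,+,-,;,{}^{\smile},1')$, where $A$ is a non-empty set, $+$ and $;$ are binary operations on $A$, $-$ and ${}^{\smile}$ are unary operations on $A$, and $1'$ is a distinguished element of $A$. Unary operations bind more tightly than binary ones, and $;$ binds more tightly than $+$. An axiom is valid in $\mathfrak{A}$ if it holds for all elements $r,s,t\in A$; otherwise it fails in $\mathfrak{A}$. The axioms of $\mathcal{R}$ are: (R1) $r+s=s+r$; (R2) $r+(s+t)=(r+s)+t$; (R3) $-(-r+s)+-(-r+-s)=r$; (R4) $r;(s;t)=(r;s);t$; (R5) $r;1'=r$; (R6) $(r^{\smile})^{\smile}=r$; (R8$'$) $r;(s+t)=r;s+r;t$; (R9) $(r+s)^{\smile}=r^{\smile}+s^{\smile}$; (R10) $r^{\smile};-(r;s)+-s=-s$, i.e. $\bigl((r^{\smile});(-(r;s))\bigr)+(-s)=-s$. A set of axioms is independent if none of the axioms in it can be derived from the remaining ones; for each axiom this is witnessed by a model in which that axiom fails and all the remaining axioms are valid. *)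

(* Defs.v *)
From Stdlib Require Import List.
Import ListNotations.

(** The carrier is non-empty because it contains [one]. *)
Record algebra : Type := Algebra {
  carrier :> Type;
  add : carrier -> carrier -> carrier;
  neg : carrier -> carrier;
  comp : carrier -> carrier -> carrier;
  conv : carrier -> carrier;
  one : carrier
}.

Inductive term : Type :=
| Var (n : nat)
| Add (t u : term)
| Neg (t : term)
| Comp (t u : term)
| Conv (t : term)
| One.

Record equation : Type := Equation { lhs : term; rhs : term }.

Fixpoint eval (A : algebra) (v : nat -> A) (t : term) : A :=
  match t with
  | Var n => v n
  | Add t u => add A (eval A v t) (eval A v u)
  | Neg t => neg A (eval A v t)
  | Comp t u => comp A (eval A v t) (eval A v u)
  | Conv t => conv A (eval A v t)
  | One => one A
  end.

Definition valid (A : algebra) (e : equation) : Prop :=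
  forall v : nat -> A, eval A v (lhs e) = eval A v (rhs e).

Definition fails (A : algebra) (e : equation) : Prop := ~ valid A e.

Fixpoint subst (f : nat -> term) (t : term) : term :=
  match t with
  | Var n => f n
  | Add t u => Add (subst f t) (subst f u)
  | Neg t => Neg (subst f t)
  | Comp t u => Comp (subst f t) (subst f u)
  | Conv t => Conv (subst f t)
  | One => One
  end.

(** Equational logic: [provable E t u] holds when [t = u] is in the least
    congruence on terms containing all substitution instances of [E]. *)
Inductive provable (E : equation -> Prop) : term -> term -> Prop :=
| provable_axiom (e : equation) (f : nat -> term) :
    E e -> provable E (subst f (lhs e)) (subst f (rhs e))
| provable_refl t : provable E t t
| provable_sym t u : provable E t u -> provable E u t
| provable_trans t u w :
    provable E t u -> provable E u w -> provable E t w
| provable_Add t t' u u' :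
    provable E t t' -> provable E u u' -> provable E (Add t u) (Add t' u')
| provable_Neg t t' : provable E t t' -> provable E (Neg t) (Neg t')
| provable_Comp t t' u u' :
    provable E t t' -> provable E u u' -> provable E (Comp t u) (Comp t' u')
| provable_Conv t t' : provable E t t' -> provable E (Conv t) (Conv t').

Definition derivable (E : equation -> Prop) (e : equation) : Prop :=
  provable E (lhs e) (rhs e).

Definition others (E : equation -> Prop) (phi : equation) : equation -> Prop :=
  fun psi => E psi /\ psi <> phi.

Definition independent (E : equation -> Prop) : Prop :=
  forall phi, E phi -> ~ derivable (others E phi) phi.

Declare Scope term_scope.
Delimit Scope term_scope with term.
Local Open Scope term_scope.
(** Levels: unary operations bind tighter than [;;], which binds tighter than
    [+]. *)
Local Notation "x ⌣" := (Conv x) (at level 1, left associativity, format "x ⌣") : term_scope.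
Local Notation "- x" := (Neg x) : term_scope.
Local Notation "x ;; y" := (Comp x y) (at level 40, left associativity) : term_scope.
Local Notation "x + y" := (Add x y) : term_scope.
Local Notation "x ≈ y" := (Equation x y) (at level 70) : term_scope.
Local Notation "1'" := One : term_scope.
Local Notation r := (Var 0).
Local Notation s := (Var 1).
Local Notation t := (Var 2).

Definition R1 : equation := r + s ≈ s + r.
Definition R2 : equation := r + (s + t) ≈ (r + s) + t.
Definition R3 : equation := -(-r + s) + -(-r + -s) ≈ r.
Definition R4 : equation := r ;; (s ;; t) ≈ (r ;; s) ;; t.
Definition R5 : equation := r ;; 1' ≈ r.
Definition R6 : equation := (r⌣)⌣ ≈ r.
Definition R8' : equation := r ;; (s + t) ≈ r ;; s + r ;; t.
Definition R9 : equation := (r + s)⌣ ≈ r⌣ + s⌣.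
Definition R10 : equation := r⌣ ;; -(r ;; s) + -s ≈ -s.

Definition calR (phi : equation) : Prop :=
  In phi [R1; R2; R3; R4; R5; R6; R8'; R9; R10].

(* Main.v *)
(** Equational logic is sound, so both halves of the theorem follow from nine
    small models.  In a finite model of (R1)-(R3), (R5), (R6), (R8') and (R10),
    which is a Boolean algebra, an element [r] amounts to a relation [F_r] on
    the atoms, with [r;s = F_r[s]] and [r = F_r[1']], and the converse of [r] to
    the converse of [F_r]; a failure of (R4) or (R9) is then a choice of
    relations not closed under composition, or whose converses do not respect
    unions. *)
From Stdlib Require Import Bool.
Require Import Defs.

Lemma eval_subst (A : algebra) (v : nat -> A) (f : nat -> term) (t : term) :
  eval A v (subst f t) = eval A (fun n => eval A v (f n)) t.
Proof. induction t; simpl; congruence. Qed.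

Lemma provable_sound (E : equation -> Prop) (A : algebra) :
  (forall e, E e -> valid A e) ->
  forall t u, provable E t u -> forall v, eval A v t = eval A v u.
Proof.
  intros HE t u Htu v.
  induction Htu; simpl; try congruence.
  rewrite !eval_subst. now apply HE.
Qed.

Definition separates (E : equation -> Prop) (A : algebra) (phi : equation) : Prop :=
  fails A phi /\ forall psi, others E phi psi -> valid A psi.

Lemma separates_not_derivable (E : equation -> Prop) (A : algebra) (phi : equation) :
  separates E A phi -> ~ derivable (others E phi) phi.
Proof.
  intros [Hfails Hvalid] Hder. apply Hfails.
  exact (provable_sound _ _ Hvalid _ _ Hder).
Qed.

Definition valuation {T : Type} (x y z : T) (n : nat) : T :=
  match n with 0 => x | 1 => y | _ => z end.

Ltac refute x y z :=
  let H := fresh in intro H; specialize (H (valuation x y z)); discriminate H.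

Ltac check_valid :=
  let v := fresh in
  intro v; simpl; generalize (v 0) (v 1) (v 2); clear v;
  simpl; intros;
  repeat match goal with
  | x : _ * _ |- _ => destruct x
  | x : bool |- _ => destruct x
  | x : comparison |- _ => destruct x
  end;
  reflexivity.

Ltac separate x y z :=
  split;
  [ refute x y z
  | let psi := fresh in let Hin := fresh in let Hne := fresh in
    intros psi [Hin Hne];
    repeat destruct Hin as [<- | Hin];
    (* [contradiction] covers the excluded axiom itself and the end of the list. *)
    solve [contradiction | check_valid] ].

(** With left projection as addition and the identity as complement, (R10) says
    that [r⌣] inverts [r], as in any group of exponent two with trivial
    converse. *)
Definition model_R1 : algebra :=
  Algebra bool (fun r _ => r) (fun r => r) xorb (fun r => r) false.

Lemma separates_R1 : separates calR model_R1 R1.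
Proof. separate true false false. Qed.

(** The carrier is Z/3Z with [Eq], [Lt], [Gt] standing for 0, -1, 1, and its
    usual negation and multiplication; addition is altered to be idempotent. *)
Definition model_R2 : algebra :=
  Algebra comparison
    (fun r s => match r, s with
                | Eq, x | x, Eq => x
                | Lt, Lt => Lt
                | Gt, Gt => Gt
                | _, _ => Eq
                end)
    CompOpp
    (fun r s => match r with Eq => Eq | Lt => CompOpp s | Gt => s end)
    (fun r => r) Gt.

Lemma separates_R2 : separates calR model_R2 R2.
Proof. separate Lt Lt Gt. Qed.

(** The constant complement makes both sides of (R10) [true]. *)
Definition model_R3 : algebra :=
  Algebra bool orb (fun _ => true) andb (fun r => r) true.

Lemma separates_R3 : separates calR model_R3 R3.
Proof. separate false false false. Qed.

(** Subsets of a two-element set: a proper subset [r] acts by intersection and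
    the full set, which is [1'], by exchanging the two points. *)
Definition model_R4 : algebra :=
  Algebra (bool * bool)
    (fun '(a, b) '(x, y) => (a || x, b || y))
    (fun '(a, b) => (negb a, negb b))
    (fun '(a, b) '(x, y) => if a && b then (y, x) else (a && x, b && y))
    (fun r => r) (true, true).

Lemma separates_R4 : separates calR model_R4 R4.
Proof. separate (true, true) (true, true) (true, false). Qed.

(** Zero composition reduces (R10) to [-s = -s]. *)
Definition model_R5 : algebra :=
  Algebra bool orb negb (fun _ _ => false) (fun r => r) true.

Lemma separates_R5 : separates calR model_R5 R5.
Proof. separate true true true. Qed.

Definition model_R6 : algebra :=
  Algebra bool orb negb andb (fun _ => false) true.

Lemma separates_R6 : separates calR model_R6 R6.
Proof. separate true true true. Qed.

(** [eqb] is the group operation of Z/2Z with unit [true], and [negb] is a translation; hence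
    [r;-(r;s) = -s], which gives (R10). *)
Definition model_R8' : algebra :=
  Algebra bool orb negb eqb (fun r => r) true.

Lemma separates_R8' : separates calR model_R8' R8'.
Proof. separate false false true. Qed.

Definition two_points (r : bool * bool * bool) : bool :=
  match r with
  | (true, true, false) | (true, false, true) | (false, true, true) => true
  | _ => false
  end.

Definition union (r s : bool * bool * bool) : bool * bool * bool :=
  let '(a, b, c) := r in let '(x, y, z) := s in (a || x, b || y, c || z).

(** Subsets of Z/3Z, where [r;s] is the union of the translates [r + i], [i] in
    [s], except that a two-element [r] is translated by [-i] instead.  This
    makes the relations of two-element sets symmetric, so their converse is the
    identity, while the converse of a singleton is still its negative. *)
Definition model_R9 : algebra :=
  Algebra (bool * bool * bool) union
    (fun '(a, b, c) => (negb a, negb b, negb c))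
    (fun r '(x, y, z) =>
       let '(a, b, c) := r in
       let y' := if two_points r then z else y in
       let z' := if two_points r then y else z in
       union (x && a, x && b, x && c)
         (union (y' && c, y' && a, y' && b) (z' && b, z' && c, z' && a)))
    (fun r => let '(a, b, c) := r in if two_points r then r else (a, c, b))
    (true, false, false).

Lemma separates_R9 : separates calR model_R9 R9.
Proof. separate (true, false, false) (false, true, false) (false, false, false). Qed.

(** Join distributes over itself, but [true] absorbs under it, against (R10). *)
Definition model_R10 : algebra :=
  Algebra bool orb negb orb (fun r => r) false.

Lemma separates_R10 : separates calR model_R10 R10.
Proof. separate true true true. Qed.

Lemma calR_separated (phi : equation) :
  calR phi -> exists A, separates calR A phi.
Proof.
  intro Hphi.
  repeat destruct Hphi as [<- | Hphi]; [ .. | contradiction ]; eexists;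
  [ exact separates_R1 | exact separates_R2 | exact separates_R3
  | exact separates_R4 | exact separates_R5 | exact separates_R6
  | exact separates_R8' | exact separates_R9 | exact separates_R10 ].
Qed.

Theorem theorem3 :
  independent calR /\
  (forall phi : equation, calR phi ->
     exists A : algebra,
       fails A phi /\ (forall psi : equation, others calR phi psi -> valid A psi)).
Proof.
  split; [ | exact calR_separated ].
  intros phi Hphi. destruct (calR_separated phi Hphi) as [A HA].
  exact (separates_not_derivable _ _ _ HA).
Qed.
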